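(* Let $R$ be a ring, let $\mathcal C$ be a full subcategory of $\operatorname{Mod-}R$ all of whose objects are indecomposable slender right $R$-modules, and let $\mathcal P,\mathcal Q$ be completely prime ideals of $\mathcal C$ such that for every $A\in\operatorname{Ob}(\mathcal C)$ an endomorphism $f\colon A\to A$ is an automorphism if and only if $f\notin\mathcal P(A,A)\cup\mathcal Q(A,A)$. Assume $\mathcal C$ satisfies Condition (DSP). Let $\{A_i\mid i\in I\}$ and $\{B_j\mid j\in J\}$ be families of objects of $\mathcal C$ with $|I|$ and $|J|$ non-measurable cardinals. Assume: (a) in each of the two families, each $\mathcal P$ class contains at most countably many members; (b) in each of the two families, each $\mathcal Q$ class contains at most countably many members; (c) $\prod_{i\in I}A_i\cong\prod_{j\in J}B_j$. Then there exist bijections $\sigma,\tau\colon I\to J$ with $[A_i]_{\mathcal P}=[B_{\sigma(i)}]_{\mathcal P}$ and $[A_i]_{\mathcal Q}=[B_{\tau(i)}]_{\mathcal Q}$ for every $i\in I$.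
   Context: A completely prime ideal $\mathcal P$ of a full subcategory $\mathcal C$ of $\operatorname{Mod-}R$ consists of a subgroup $\mathcal P(A,B)$ of $\operatorname{Hom}_R(A,B)$ for each pair of objects $A,B$ of $\mathcal C$ such that: (1) for all objects $A,B,C$ and morphisms $f\colon A\to B$, $g\colon B\to C$, one has $gf\in\mathcal P(A,C)$ if and only if $f\in\mathcal P(A,B)$ or $g\in\mathcal P(B,C)$; (2) $\mathcal P(A,A)\neq\operatorname{Hom}_R(A,A)$ for every object $A$. For objects $A,B$, write $[A]_{\mathcal P}=[B]_{\mathcal P}$ (''same $\mathcal P$ class'') if $\mathcal P(A,B)\ne\operatorname{Hom}_R(A,B)$ and $\mathcal P(B,A)\neq\operatorname{Hom}_R(B,A)$. $\mathcal C$ satisfies Condition (DSP) if whenever $A,B,C,D$ are right $R$-modules with $A\oplus B\cong C\oplus D$ and $A,B,C\in\operatorname{Ob}(\mathcal C)$, then $D\in\operatorname{Ob}(\mathcal C)$. A right $R$-module $M$ is slender if for every homomorphism $f\colon R^\omega=\prod_{n<\omega}e_nR\to M$ (with $e_n$ the element having $1$ in position $n$ and $0$ elsewhere) there is $n_0$ with $f(e_n)=0$ for all $n\ge n_0$. *)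

(* Defs.v *)
(* Right R-modules are modelled as left modules over the
   converse ring R^c, i.e. as [lmodType R^c]; for m : M and r : R the right
   action m.r is written  (r : R^c) *: m . *)
From HB Require Import structures.
From mathcomp Require Import all_boot all_order all_algebra.

Set Implicit Arguments. Unset Strict Implicit. Unset Printing Implicit Defensive.
Import GRing.Theory.
Local Open Scope ring_scope.

Section Defs.
Variable R : pzRingType.
Notation rmod := (lmodType R^c).

Definition rhom (A B : rmod) (f : A -> B) : Prop :=
  (forall x y : A, f (x + y) = f x + f y) /\
  (forall (r : R^c) (x : A), f (r *: x) = r *: f x).

Definition module_iso (A B : rmod) (f : A -> B) : Prop := rhom f /\ bijective f.

Definition module_automorphism (A : rmod) (f : A -> A) : Prop := module_iso f.

Definition submodule (M : rmod) (N : M -> Prop) : Prop :=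
  N 0 /\ (forall x y, N x -> N y -> N (x + y)) /\
  (forall (r : R^c) x, N x -> N (r *: x)).

Definition indecomposable (M : rmod) : Prop :=
  (exists m : M, m <> 0) /\
  forall N1 N2 : M -> Prop, submodule N1 -> submodule N2 ->
    (forall m, N1 m -> N2 m -> m = 0) ->
    (forall m, exists n1 n2, N1 n1 /\ N2 n2 /\ m = n1 + n2) ->
    (forall m, N1 m -> m = 0) \/ (forall m, N2 m -> m = 0).

Definition e_omega (n : nat) : nat -> R := fun m => if m == n then 1 else 0.

Definition slender (M : rmod) : Prop :=
  forall f : (nat -> R) -> M,
    (forall x y, f (fun n => x n + y n) = f x + f y) ->
    (forall (x : nat -> R) (r : R), f (fun n => x n * r) = (r : R^c) *: f x) ->
    exists n0, forall n, (n0 <= n)%N -> f (e_omega n) = 0.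

(* The full subcategory C is given by its class of objects [Ob].
   A completely prime ideal of C. *)
Definition completely_prime (Ob : rmod -> Prop)
    (P : forall A B : rmod, (A -> B) -> Prop) : Prop :=
  (forall A B, Ob A -> Ob B ->
     (forall f, P A B f -> rhom f) /\
     P A B (fun _ => 0) /\
     (forall f g, P A B f -> P A B g -> P A B (fun x => f x - g x))) /\
  (forall A B C, Ob A -> Ob B -> Ob C ->
     forall (f : A -> B) (g : B -> C), rhom f -> rhom g ->
       (P A C (fun x => g (f x)) <-> P A B f \/ P B C g)) /\
  (forall A, Ob A -> exists f : A -> A, rhom f /\ ~ P A A f).

Definition same_class (P : forall A B : rmod, (A -> B) -> Prop) (A B : rmod) : Prop :=
  (exists f : A -> B, rhom f /\ ~ P A B f) /\ (exists g : B -> A, rhom g /\ ~ P B A g).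

Definition dsum_iso (A B C D : rmod) (phi : A * B -> C * D) : Prop :=
  bijective phi /\
  (forall a a' b b', phi (a + a', b + b') =
      ((phi (a, b)).1 + (phi (a', b')).1, (phi (a, b)).2 + (phi (a', b')).2)) /\
  (forall (r : R^c) a b, phi (r *: a, r *: b) =
      (r *: (phi (a, b)).1, r *: (phi (a, b)).2)).

Definition DSP (Ob : rmod -> Prop) : Prop :=
  forall A B C D : rmod, Ob A -> Ob B -> Ob C ->
    (exists phi : A * B -> C * D, dsum_iso phi) -> Ob D.

Definition prod_iso (I J : Type) (A : I -> rmod) (B : J -> rmod)
    (Phi : (forall i, A i) -> (forall j, B j)) : Prop :=
  bijective Phi /\
  (forall x y, Phi (fun i => x i + y i) = (fun j => Phi x j + Phi y j)) /\
  (forall (r : R^c) x, Phi (fun i => r *: x i) = (fun j => r *: Phi x j)).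

End Defs.

Definition countable_set (T : Type) (S : T -> Prop) : Prop :=
  exists h : {x : T | S x} -> nat, injective h.

(* A set I has non-measurable cardinality: every countably complete
   ultrafilter on I is principal (Ulam/Los sense, as used for slender
   modules). *)
Definition ultrafilter (I : Type) (U : (I -> Prop) -> Prop) : Prop :=
  U (fun _ => True) /\ ~ U (fun _ => False) /\
  (forall X Y, U X -> (forall i, X i -> Y i) -> U Y) /\
  (forall X Y, U X -> U Y -> U (fun i => X i /\ Y i)) /\
  (forall X, U X \/ U (fun i => ~ X i)).

Definition countably_complete (I : Type) (U : (I -> Prop) -> Prop) : Prop :=
  forall X : nat -> I -> Prop, (forall n, U (X n)) -> U (fun i => forall n, X n i).

Definition principal (I : Type) (U : (I -> Prop) -> Prop) : Prop :=
  exists i0, U (fun i => i = i0).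

Definition nonmeasurable (I : Type) : Prop :=
  forall U : (I -> Prop) -> Prop, ultrafilter U -> countably_complete U -> principal U.

(* Main.v *)
(** A homomorphism from a product indexed by a non-measurable set to a slender
    module depends on finitely many coordinates only. Hence, for finitely many
    indices j, the isomorphism and its inverse exhibit the finite sum of the
    B_j as a direct summand of the sum of finitely many A_i, and, modulo P,
    only the A_i in the P class of the B_j matter. Since endomorphism rings are
    local modulo P, Gaussian elimination modulo P applies and shows that at
    most as many B_j as A_i lie in a given P class. By symmetry, and since the
    classes are countable, corresponding classes have the same cardinality.
    The same argument works for Q. *)
Require Import Defs.
From HB Require Import structures.
From mathcomp Require Import all_boot all_order all_algebra.
From mathcomp Require Import finmap boolp classical_sets functions cardinality.
Set Implicit Arguments.
Unset Strict Implicit.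
Unset Printing Implicit Defensive.

Import GRing.Theory.
Local Open Scope ring_scope.

(** * Homomorphisms from products to slender modules *)

Section SlenderTarget.
Context {R : pzRingType} {I : choiceType} {A : I -> lmodType R^c} {M : lmodType R^c}.
Context {f : (forall i, A i) -> M}.
Hypothesis fD : forall x y, f (fun i => x i + y i) = f x + f y.
Hypothesis fZ : forall (r : R^c) x, f (fun i => r *: x i) = r *: f x.
Hypothesis slM : slender M.

(** The analogue of measure zero: these sets form a countably complete ideal. *)
Definition null_support (X : I -> Prop) : Prop :=
  forall x, (forall i, ~ X i -> x i = 0) -> f x = 0.

(** Only finitely many [x n] are nonzero at each coordinate, so the infinite combination of the
    [x n] with coefficients [r n] makes sense. It gives a homomorphism on the countable power of [R]
    sending the [n]-th unit vector to [f (x n)]. *)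
Lemma slender_pointwise_finite (x : nat -> forall i, A i) (N : I -> nat) :
  (forall i n, (N i <= n)%N -> x n i = 0) ->
  exists n0, forall n, (n0 <= n)%N -> f (x n) = 0.
Proof.
move=> xN.
pose F (r : nat -> R) := f (fun i => \sum_(n < N i) (r n : R^c) *: x n i).
have Fe n : F (e_omega R n) = f (x n).
  congr f; apply: functional_extensionality_dep => i.
  have [ltn|len] := ltnP n (N i); last first.
    rewrite (xN i n len) big1 // => m _; rewrite /e_omega.
    by rewrite ltn_eqF ?scale0r // (leq_trans _ len).
  rewrite (bigD1 (Ordinal ltn)) //= /e_omega eqxx scale1r big1 ?addr0 // => m.
  by rewrite -val_eqE /= => /negPf ->; rewrite scale0r.
have [||n0 Hn0] := @slM F.
- move=> r s; rewrite /F -fD; congr f.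
  apply: functional_extensionality_dep => i.
  by rewrite -big_split; apply: eq_bigr => n _; rewrite scalerDl.
- move=> r s; rewrite /F -fZ; congr f.
  apply: functional_extensionality_dep => i.
  by rewrite scaler_sumr; apply: eq_bigr => n _; rewrite scalerA.
by exists n0 => n len; rewrite -Fe Hn0.
Qed.

(** Otherwise there are [x n] supported in [X n] with [f (x n)] nonzero; at each coordinate at most
    one of them is nonzero, against slenderness. *)
Lemma null_support_disjoint (X : nat -> I -> Prop) :
  (forall m n i, X m i -> X n i -> m = n) -> exists n, null_support (X n).
Proof.
move=> Xdisj; apply: contrapT => /forallNP nX.
have /choice[x Hx] n :
    exists x, (forall i, ~ X n i -> x i = 0) /\ f x <> 0.
  by apply: contrapT => nx; apply: (nX n) => x x0; apply: contrapT => fx; apply: nx; exists x.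
have /choice[N HN] i : exists N, forall n, (N <= n)%N -> x n i = 0.
  have [[m Xmi]|nXi] := pselect (exists m, X m i); last first.
    by exists 0%N => n _; apply: (Hx n).1 => Xni; apply: nXi; exists n.
  exists m.+1 => n ltmn; apply: (Hx n).1 => Xni.
  by move: ltmn; rewrite (Xdisj _ _ _ Xmi Xni) ltnn.
by have [n0 /(_ n0 (leqnn _))] := slender_pointwise_finite HN; apply: (Hx n0).2.
Qed.

Lemma null_support_sub (X Y : I -> Prop) :
  (forall i, X i -> Y i) -> null_support Y -> null_support X.
Proof. by move=> XY nY x Xx; apply: nY => i nYi; apply: Xx => /XY. Qed.

(** Erasing [x] on the first [n] sets does not change [f x]. Every nonzero coordinate is erased at
    some stage, so slenderness gives the value zero. *)
Lemma null_support_bigcup (X : nat -> I -> Prop) :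
  (forall n, null_support (X n)) -> null_support (fun i => exists n, X n i).
Proof.
move=> nX x xX.
pose z n i := if `[< exists2 m, (m < n)%N & X m i >] then 0 else x i.
have z0 n m i : (m < n)%N -> X m i -> z n i = 0.
  by move=> ltmn Xm; rewrite /z asboolT //; exists m.
have fz n : f (z n) = f x.
  elim: n => [|n IHn].
    congr f; apply: functional_extensionality_dep => i.
    by rewrite /z asboolF // => -[].
  pose y i := if `[< X n i >] then z n i else 0.
  have fy : f y = 0 by apply: (nX n) => i nXi; rewrite /y asboolF.
  rewrite -IHn -[LHS]addr0 -fy -fD; congr f.
  apply: functional_extensionality_dep => i; rewrite /y.
  have [Xni|nXni] := pselect (X n i).
    by rewrite (z0 n.+1 n) // asboolT // add0r.
  rewrite (asboolF nXni) addr0 /z; congr (if _ then _ else _).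
  apply: asbool_equiv_eq; split=> -[m ltm Xm]; exists m => //; last exact: ltnW.
  by move: ltm; rewrite ltnS leq_eqVlt => /orP[/eqP mn|//]; case: nXni; rewrite -mn.
have /choice[N HN] i : exists N, forall n, (N <= n)%N -> z n i = 0.
  have [[m Xmi]|nXi] := pselect (exists m, X m i).
    by exists m.+1 => n ltmn; apply: z0 Xmi.
  by exists 0%N => n _; rewrite /z xX ?if_same.
by have [n0 /(_ n0 (leqnn _))] := slender_pointwise_finite HN; rewrite fz.
Qed.

Lemma null_support_cover2 (X Y Z : I -> Prop) :
  (forall i, Z i -> X i \/ Y i) -> null_support X -> null_support Y ->
  null_support Z.
Proof.
move=> ZXY nX nY.
apply: (@null_support_sub _ (fun i => exists n : nat, (if n == 0%N then X else Y) i)).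
  by move=> i /ZXY[Xi|Yi]; [exists 0%N|exists 1%N].
by apply: null_support_bigcup => n; case: ifP.
Qed.

Lemma null_support0 (X : I -> Prop) : (forall i, ~ X i) -> null_support X.
Proof.
move=> X0 x x0.
have -> : x = (fun i => (0 : R^c) *: x i).
  by apply: functional_extensionality_dep => i; rewrite x0 ?scale0r.
by rewrite fZ scale0r.
Qed.

Hypothesis nmI : nonmeasurable I.

Definition diffuse (Y : I -> Prop) : Prop :=
  ~ null_support Y /\ forall i, Y i -> null_support (fun k => k = i).

(* Otherwise the sets with null complement in Y would form a countably
   complete ultrafilter, whose generator would be a non-null point of Y. *)
Lemma diffuse_split (Y : I -> Prop) : diffuse Y ->
  exists W, [/\ forall i, W i -> Y i, diffuse W &
                ~ null_support (fun i => Y i /\ ~ W i)].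
Proof.
move=> [nY Ypt]; apply: contrapT => nsplit.
(* A non-null subset of [Y] is again diffuse, so failure of splitting forces a zero-one law. *)
have atom W : (forall i, W i -> Y i) ->
    null_support W \/ null_support (fun i => Y i /\ ~ W i).
  move=> WY; apply: contrapT => /not_orP[nW nYW].
  by apply: nsplit; exists W; split=> //; split=> // i /WY; apply: Ypt.
pose U X := null_support (fun i => Y i /\ ~ X i).
have [||i0 Ui0] := @nmI U.
- split; first by apply: null_support0 => i [_ []].
  split; first by move=> U0; apply: nY; apply: null_support_sub U0 => i Yi; split=> // -[].
  split.
    by move=> X X' UX XX'; apply: null_support_sub UX => i [Yi nX]; split=> // /XX'.
  split=> [X X' UX UX'|X].
    apply: null_support_cover2 UX UX' => i [Yi] /not_andP[nXi|nXi]; first by left.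
    by right.
  have [|nYX|nYX] := atom (fun i => Y i /\ ~ X i); first by move=> i [].
    by left.
  right; apply: null_support_sub nYX => i [Yi /contrapT Xi].
  by split=> // -[].
- move=> X UX; apply: null_support_sub (null_support_bigcup UX) => i [Yi].
  by move=> /existsNP[n nXn]; exists n.
have [Yi0|nYi0] := pselect (Y i0).
  apply: nY; apply: null_support_cover2 Ui0 (Ypt _ Yi0) => i Yi.
  by have [->|ni] := pselect (i = i0); [right|left].
by apply: nY; apply: null_support_sub Ui0 => i Yi; split=> // ii0; apply: nYi0; rewrite -ii0.
Qed.

(** Iterated splitting gives a decreasing sequence of diffuse sets whose successive differences are
    disjoint and non-null. *)
Lemma not_diffuse (Y : I -> Prop) : ~ diffuse Y.
Proof.
move=> dY.
have /choice[next Hnext] (Z : {Z | diffuse Z}) : exists W : {W | diffuse W},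
    (forall i, sval W i -> sval Z i) /\
    ~ null_support (fun i => sval Z i /\ ~ sval W i).
  by case: Z => Z dZ; have [W [WZ dW nZW]] := diffuse_split dZ; exists (exist _ W dW).
pose Z n := sval (iter n next (exist _ Y dY)).
have Zdecr m n i : (m <= n)%N -> Z n i -> Z m i.
  move=> /subnK <-; elim: (n - m)%N => // k IHk; rewrite addSn => Zi.
  exact/IHk/(Hnext (iter (k + m) next (exist _ Y dY))).1.
have [|n] := @null_support_disjoint (fun n i => Z n i /\ ~ Z n.+1 i).
  move=> m n i [Zm nZm] [Zn nZn]; case: (ltngtP m n) => // lt_.
  - by case: nZm; apply: Zdecr Zn.
  - by case: nZn; apply: Zdecr Zm.
exact: (Hnext (iter n next (exist _ Y dY))).2.
Qed.

(** The support consists of the non-null points. They are finitely many, being disjoint singletons,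
    and their complement is null since it would otherwise be diffuse. *)
Lemma hom_prod_slender_finite_support : exists F : seq I,
  uniq F /\ forall x, (forall i, i \in F -> x i = 0) -> f x = 0.
Proof.
pose G : set I := fun i => ~ null_support (fun k => k = i).
have finG : finite_set G.
  apply: contrapT => /infiniteP/card_leP[h].
  pose g n : I := \val (h (SigSub (mem_setT n))).
  have [|n] := @null_support_disjoint (fun n i => i = g n).
    by move=> m n _ -> /val_inj /inj; rewrite !inE => /(_ Logic.I Logic.I) [].
  exact: (set_mem (valP (h (SigSub (mem_setT n))))).
have [F GF] := finite_fsetP.1 finG; exists F; split=> [|x xF].
  exact: fset_uniq.
apply: (contrapT (P := _)) => fx; apply: (@not_diffuse (fun i => ~ G i)); split.
  by move=> nG; apply/fx/nG => i /contrapT Gi; apply: xF; move: Gi; rewrite GF.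
by move=> i /contrapT.
Qed.

End SlenderTarget.


(** * Module homomorphisms *)

Section ModuleHom.
Context {R : pzRingType}.
Implicit Types A B C : lmodType R^c.

Lemma rhom0 {A B} {f : A -> B} : rhom f -> f 0 = 0.
Proof. by move=> [_ fZ]; rewrite -[X in f X](scale0r 0) fZ scale0r. Qed.

Lemma rhomN {A B} {f : A -> B} : rhom f -> {morph f : x / - x}.
Proof. by move=> [_ fZ] x; rewrite -scaleN1r fZ scaleN1r. Qed.

Lemma rhomB {A B} {f : A -> B} : rhom f -> {morph f : x y / x - y}.
Proof. by move=> hf x y; rewrite hf.1 rhomN. Qed.

Lemma rhom_sum {A B} {f : A -> B} (T : Type) (s : seq T) (F : T -> A) :
  rhom f -> f (\sum_(i <- s) F i) = \sum_(i <- s) f (F i).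
Proof. by move=> hf; apply: (big_morph f hf.1 (rhom0 hf)). Qed.

Lemma rhom_id A : rhom (fun x : A => x).
Proof. by []. Qed.

Lemma rhom_comp {A B C} {f : A -> B} {g : B -> C} :
  rhom f -> rhom g -> rhom (fun x => g (f x)).
Proof. by move=> [fD fZ] [gD gZ]; split=> [x y|r x]; rewrite ?fD ?gD ?fZ ?gZ. Qed.

Lemma rhom_sub {A B} {f g : A -> B} :
  rhom f -> rhom g -> rhom (fun x => f x - g x).
Proof.
move=> [fD fZ] [gD gZ]; split=> [x y|r x]; last by rewrite fZ gZ scalerBr.
by rewrite fD gD opprD addrACA.
Qed.

Lemma rhom_add {A B} {f g : A -> B} :
  rhom f -> rhom g -> rhom (fun x => f x + g x).
Proof.
move=> [fD fZ] [gD gZ]; split=> [x y|r x]; last by rewrite fZ gZ scalerDr.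
by rewrite fD gD addrACA.
Qed.

Lemma automorphism_inverse {A} {f : A -> A} : module_automorphism f ->
  exists c, [/\ rhom c, forall x, c (f x) = x & forall x, f (c x) = x].
Proof.
move=> [[fD fZ] [c fK cK]]; exists c; split=> //.
by split=> [x y|r x]; apply: (can_inj fK); rewrite ?fD ?fZ !cK.
Qed.

End ModuleHom.

(** * Completely prime ideals and their classes *)

Section CompletelyPrime.
Context {R : pzRingType} {Ob : lmodType R^c -> Prop}.
Context {P : forall A B : lmodType R^c, (A -> B) -> Prop}.
Arguments P : clear implicits.
Hypothesis HP : completely_prime Ob P.
Implicit Types A B C : lmodType R^c.

Lemma ideal_hom A B f : Ob A -> Ob B -> P A B f -> rhom f.
Proof. by move=> oA oB; apply: (HP.1 _ _ oA oB).1. Qed.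

Lemma ideal0 A B : Ob A -> Ob B -> P A B (fun _ => 0).
Proof. by move=> oA oB; apply: (HP.1 _ _ oA oB).2.1. Qed.

Lemma ideal_sub A B f g : Ob A -> Ob B -> P A B f -> P A B g ->
  P A B (fun x => f x - g x).
Proof. by move=> oA oB; apply: (HP.1 _ _ oA oB).2.2. Qed.

Lemma ideal_add A B f g : Ob A -> Ob B -> P A B f -> P A B g ->
  P A B (fun x => f x + g x).
Proof.
move=> oA oB Pf Pg; have := ideal_sub oA oB Pf (ideal_sub oA oB (ideal0 oA oB) Pg).
by congr P; apply/funext => x; rewrite sub0r opprK.
Qed.

Lemma ideal_sum A B (T : Type) (s : seq T) (p : pred T) (f : T -> A -> B) :
  Ob A -> Ob B -> (forall i, p i -> P A B (f i)) ->
  P A B (fun x => \sum_(i <- s | p i) f i x).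
Proof.
move=> oA oB Pf; elim: s => [|i s IHs].
  by have := ideal0 oA oB; congr P; apply/funext => x; rewrite big_nil.
case pi: (p i); last first.
  by move: IHs; congr P; apply/funext => x; rewrite big_cons pi.
by have := ideal_add oA oB (Pf i pi) IHs; congr P; apply/funext => x; rewrite big_cons pi.
Qed.

Lemma ideal_compl A B C f g : Ob A -> Ob B -> Ob C -> P A B f -> rhom g ->
  P A C (fun x => g (f x)).
Proof.
move=> oA oB oC Pf hg; apply/(HP.2.1 A B C) => //; last by left.
exact: ideal_hom Pf.
Qed.

Lemma ideal_compr A B C f g : Ob A -> Ob B -> Ob C -> rhom f -> P B C g ->
  P A C (fun x => g (f x)).
Proof.
move=> oA oB oC hf Pg; apply/(HP.2.1 A B C) => //; last by right.
exact: ideal_hom Pg.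
Qed.

Lemma ideal_prime A B C f g : Ob A -> Ob B -> Ob C -> rhom f -> rhom g ->
  P A C (fun x => g (f x)) -> P A B f \/ P B C g.
Proof. by move=> oA oB oC hf hg /(HP.2.1 A B C); apply. Qed.

(** Otherwise absorption would put every endomorphism in [P], against properness. *)
Lemma ideal_id A : Ob A -> ~ P A A (fun x => x).
Proof.
move=> oA Pid; have [f [hf]] := HP.2.2 A oA; apply.
exact: (ideal_compl (f := fun x => x)).
Qed.

Lemma same_class_refl A : Ob A -> same_class P A A.
Proof. by move=> oA; split; exists (fun x => x); split=> //; apply: ideal_id. Qed.

Lemma same_class_sym A B : same_class P A B -> same_class P B A.
Proof. by case. Qed.

(** By primeness a composite of two maps outside [P] stays outside [P]. *)
Lemma same_class_trans A B C : Ob A -> Ob B -> Ob C ->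
  same_class P A B -> same_class P B C -> same_class P A C.
Proof.
move=> oA oB oC [[f [hf nf]] [f' [hf' nf']]] [[g [hg ng]] [g' [hg' ng']]].
split; [exists (fun x => g (f x))|exists (fun x => f' (g' x))]; split;
  do ?exact: rhom_comp.
  by move=> /ideal_prime[].
by move=> /ideal_prime[].
Qed.

End CompletelyPrime.

(** * Invertibility and elimination modulo an ideal *)

Section Pivot.
Context {R : pzRingType} {Ob : lmodType R^c -> Prop}.
Context {P Q : forall A B : lmodType R^c, (A -> B) -> Prop}.
Arguments P : clear implicits.
Arguments Q : clear implicits.
Hypotheses (HP : completely_prime Ob P) (HQ : completely_prime Ob Q).
Hypothesis Haut : forall A, Ob A -> forall f : A -> A, rhom f ->
  (module_automorphism f <-> ~ (P A A f \/ Q A A f)).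
Implicit Types A B C : lmodType R^c.

(** Mutually inverse in the quotient category modulo [P]. *)
Definition inverse_mod A B (f : A -> B) (g : B -> A) : Prop :=
  P A A (fun x => g (f x) - x) /\ P B B (fun x => f (g x) - x).

(** If [c] inverts [f + h], then [c f = 1 - c h] and [f c = 1 - h c], with error terms in [P]. *)
Lemma automorphism_inverse_mod A (f h : A -> A) : Ob A -> rhom f -> P A A h ->
  module_automorphism (fun x => f x + h x) ->
  exists2 c, rhom c & inverse_mod f c.
Proof.
move=> oA hf Ph /automorphism_inverse[c [hc cK fK]]; exists c => //.
have hh := ideal_hom HP oA oA Ph.
have PN g : P A A g -> P A A (fun x => - g x).
  move=> Pg; have := ideal_sub HP oA oA (ideal0 HP oA oA) Pg.
  by congr P; apply/funext => x; rewrite sub0r.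
split.
  have := PN _ (ideal_compl HP oA oA oA Ph hc); congr P; apply/funext => x.
  by rewrite -[X in _ = _ - X](cK x) hc.1 opprD addrA subrr sub0r.
have := PN _ (ideal_compr HP oA oA oA hc Ph); congr P; apply/funext => x.
by rewrite -[X in _ = _ - X](fK x) opprD addrA subrr sub0r.
Qed.

(* The endomorphism ring modulo P is local. If P is contained in Q on B, some
   summand is outside Q, hence an automorphism. Otherwise, adding an element
   of P outside Q to any endomorphism in Q but not in P gives an automorphism,
   so that modulo P every nonzero endomorphism is invertible. *)
Lemma sum_inverse_mod B (T : Type) (s : seq T) (p : pred T) (f : T -> B -> B) :
  Ob B -> (forall i, rhom (f i)) ->
  P B B (fun x => (\sum_(i <- s | p i) f i x) - x) ->
  exists2 i, p i & exists2 c, rhom c & inverse_mod (f i) c.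
Proof.
move=> oB hf Pf.
(* Stated for any ideal, because it serves for [Q] when [P] is contained in [Q] on [B], and for [P]
   otherwise. *)
have sumN (S : forall A B : lmodType R^c, (A -> B) -> Prop) :
    completely_prime Ob S -> S B B (fun x => (\sum_(i <- s | p i) f i x) - x) ->
    exists2 i, p i & ~ S B B (f i).
  move=> HS Sf; apply: contrapT => nf; apply: (ideal_id HS oB).
  have Ssum : S B B (fun x => \sum_(i <- s | p i) f i x).
    apply: (ideal_sum HS _ oB oB) => i pi.
    by apply: contrapT => nSi; apply: nf; exists i.
  have := ideal_sub HS oB oB Ssum Sf; congr S; apply/funext => x.
  by rewrite opprB addrC subrK.
have aut i : ~ P B B (f i) -> ~ Q B B (f i) ->
    exists2 c, rhom c & inverse_mod (f i) c.
  move=> nP nQ; apply: (@automorphism_inverse_mod _ _ (fun=> 0)) => //.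
    exact: (ideal0 HP).
  rewrite (_ : (fun x => _) = f i); last by apply/funext => x; rewrite addr0.
  by apply/Haut => //; case.
have [PQ|/existsNP[h /not_implyP[Ph nQh]]] := pselect (forall h, P B B h -> Q B B h).
  have [i pi nQ] := sumN Q HQ (PQ _ Pf); exists i => //.
  by apply: aut => // /PQ.
have [i pi nP] := sumN P HP Pf; exists i => //.
have [Qf|nQ] := pselect (Q B B (f i)); last exact: aut.
apply: (automorphism_inverse_mod oB (hf i) Ph).
have hh := ideal_hom HP oB oB Ph.
apply/(Haut oB); first exact: rhom_add.
case=> H.
  apply: nP; have := ideal_sub HP oB oB H Ph.
  by congr P; apply/funext => x; rewrite addrK.
apply: nQh; have := ideal_sub HQ oB oB H Qf.
by congr Q; apply/funext => x; rewrite addrC addKr.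
Qed.

(* Gaussian elimination modulo P: an entry of [phi] and an entry of [psi]
   are invertible modulo P, so one row and one column can be removed. *)
Lemma size_le_of_identity_mod (I J : eqType) (A : I -> lmodType R^c)
    (B : J -> lmodType R^c) (js : seq J) (s : seq I)
    (phi : forall j i, A i -> B j) (psi : forall i j, B j -> A i) :
  (forall i, Ob (A i)) -> (forall j, Ob (B j)) ->
  (forall j i, rhom (phi j i)) -> (forall i j, rhom (psi i j)) ->
  uniq js ->
  {in js, forall j,
    P (B j) (B j) (fun b => (\sum_(i <- s) phi j i (psi i j b)) - b)} ->
  {in js &, forall j k, j != k ->
    P (B k) (B j) (fun b => \sum_(i <- s) phi j i (psi i k b))} ->
  (size js <= size s)%N.
Proof.
move=> oA oB + hpsi; elim: js s phi => // j0 js IHjs s phi hphi.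
rewrite cons_uniq => /andP[j0js ujs] diag offdiag.
have := diag j0 (mem_head _ _).
(* Membership in [s] is recorded in the sum so that the pivot [i0] lies in [s]. *)
under eq_fun do rewrite big_seq.
move=> /(sum_inverse_mod (oB j0) (fun i => rhom_comp (hpsi i j0) (hphi j0 i))).
move=> [i0 i0s [c hc [Pc Pc']]].
pose e := fun a => psi i0 j0 (c (phi j0 i0 a)).
have he : rhom (fun a => e a - a).
  apply: rhom_sub; last exact: rhom_id.
  exact: rhom_comp (rhom_comp (hphi j0 i0) hc) (hpsi i0 j0).
(* The composite of [e - 1] followed by [phi j0 i0] lies in [P], so one of the two does. If
   [phi j0 i0] did, so would [c phi psi], hence the identity of [B j0]. *)
have Pe : P (A i0) (A i0) (fun a => e a - a).
  have [||Pphi] // := @ideal_prime _ _ _ HP _ _ _ _ (phi j0 i0) (oA i0) (oA i0) (oB j0) he (hphi _ _).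
    have := ideal_compr HP (oA i0) (oB j0) (oB j0) (hphi j0 i0) Pc'.
    by congr P; apply/funext => a; rewrite (rhomB (hphi _ _)).
  case: (ideal_id HP (oB j0)).
  have P1 := ideal_compr HP (oB j0) (oA i0) (oB j0) (hpsi i0 j0) Pphi.
  have := ideal_sub HP (oB j0) (oB j0) (ideal_compl HP (oB j0) (oB j0) (oB j0) P1 hc) Pc.
  by congr P; apply/funext => b; rewrite opprB addrC subrK.
(* Row operation: subtract from row [j] the multiple of row [j0] that clears column [i0] modulo [P],
   since [e] is the identity modulo [P]. *)
pose phi2 j i a := phi j i a - phi j i0 (psi i0 j0 (c (phi j0 i a))).
have hcorr j : rhom (fun b => phi j i0 (psi i0 j0 (c b))).
  exact: rhom_comp (rhom_comp hc (hpsi i0 j0)) (hphi j i0).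
(* The row operation changes the product by a multiple of its off-diagonal entry at [(j0, k)], and
   dropping [i0] removes a term factoring through [e - 1]; both lie in [P]. The map [d] will be the
   identity on the diagonal and zero off it. *)
have key j k (d : B k -> B j) : k != j0 -> k \in js ->
    P (B k) (B j) (fun b => (\sum_(i <- s) phi j i (psi i k b)) - d b) ->
    P (B k) (B j) (fun b => (\sum_(i <- rem i0 s) phi2 j i (psi i k b)) - d b).
  move=> kj0 kjs Pd.
  have P0 : P (B k) (B j0) (fun b => \sum_(i <- s) phi j0 i (psi i k b)).
    by apply: offdiag; rewrite ?mem_head ?in_cons ?kjs ?orbT // eq_sym.
  have P1 := ideal_compl HP (oB k) (oB j0) (oB j) P0 (hcorr j).
  have P2 := ideal_compr HP (oB k) (oA i0) (oA i0) (hpsi i0 k) Pe.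
  have P3 := ideal_compl HP (oB k) (oA i0) (oB j) P2 (hphi j i0).
  have := ideal_add HP (oB k) (oB j) (ideal_sub HP (oB k) (oB j) Pd P1) P3.
  congr P; apply/funext => b /=.
  rewrite !(perm_big _ (perm_to_rem i0s)) !big_cons /= (hcorr j).1.
  rewrite (rhomB (hphi j i0)) -/(e _) /phi2 sumrB.
  rewrite -(rhom_sum (rem i0 s) (fun i => phi j0 i (psi i k b)) (hcorr j)).
  move: (\sum_(i <- rem i0 s) phi j i _) (phi j i0 (psi i0 j0 (c (\sum_(i <- _) _)))).
  move=> S T; rewrite /e; move: (phi j i0 _) (phi j i0 _) (d b) => u v w.
  rewrite opprD -(addrA (v + S - w)) (addrACA (- u)) addNr add0r -(addrA v) addrC addrA subrK.
  by rewrite addrC addrAC.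
have s_gt0 : (0 < size s)%N by rewrite lt0n size_eq0; apply: contraTneq i0s => ->.
rewrite /= -(prednK s_gt0) ltnS -(size_rem i0s).
have jsj0 k : k \in js -> k != j0 by apply: contraTneq => ->.
apply: (IHjs _ phi2) => // [j i|k kjs|j k jjs kjs jk].
- by apply: rhom_sub => //; apply: rhom_comp (hphi j0 i) (hcorr j).
- by apply: (key k k id) => //; [apply: jsj0|apply: diag; rewrite in_cons kjs orbT].
under eq_fun do rewrite -[\sum_(i <- _) _]subr0.
apply: (key j k (fun=> 0)) => //; first exact: jsj0.
under eq_fun do rewrite subr0.
by apply: offdiag; rewrite ?in_cons ?jjs ?kjs ?orbT.
Qed.

End Pivot.

(** * Components of maps on a product *)

Section ProductMap.
Context {R : pzRingType} {I : choiceType} {A : I -> lmodType R^c}.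

(** The canonical injection of a factor into the product; the factors have different types, so [a]
    is transported along [i = k]. *)
Definition single (i : I) (a : A i) (k : I) : A k :=
  if eqP is ReflectT ik then ecast k (A k) ik a else 0 :> A k.
Arguments single : clear implicits.

Lemma single_eq i a : single i a i = a.
Proof. by rewrite /single; case: eqP => // e; rewrite eq_axiomK. Qed.

Lemma single_neq i k a : i != k -> single i a k = 0.
Proof. by move=> /eqP ik; rewrite /single; case: eqP. Qed.

Lemma single_rhom i k : rhom (fun a => single i a k).
Proof.
have [<-|ik] := eqVneq i k; last by split=> *; rewrite !single_neq ?addr0 ?scaler0.
by split=> *; rewrite !single_eq.
Qed.

Context {M : lmodType R^c} {f : (forall i, A i) -> M}.
Hypothesis fD : forall x y, f (fun i => x i + y i) = f x + f y.
Hypothesis fZ : forall (r : R^c) x, f (fun i => r *: x i) = r *: f x.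

Lemma comp_single_rhom i : rhom (fun a => f (single i a)).
Proof.
split=> [a b|r a]; [rewrite -fD|rewrite -fZ]; congr f;
  apply: functional_extensionality_dep => k.
  exact: (single_rhom i k).1.
exact: (single_rhom i k).2.
Qed.

Lemma prod_map_sum (T : Type) (s : seq T) (g : T -> forall i, A i) :
  f (fun i => \sum_(t <- s) g t i) = \sum_(t <- s) f (g t).
Proof.
elim: s => [|t s IHs].
  rewrite big_nil -(scale0r (f (fun=> 0))) -fZ; congr f.
  by apply: functional_extensionality_dep => i; rewrite big_nil scale0r.
rewrite big_cons -IHs -fD; congr f.
by apply: functional_extensionality_dep => i; rewrite big_cons.
Qed.

(** [x] and the sum of its components over [F] agree on [F], so [f] does not distinguish them. *)
Lemma finite_support_sum (F : seq I) : uniq F ->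
  (forall x, (forall i, i \in F -> x i = 0) -> f x = 0) ->
  forall x, f x = \sum_(i <- F) f (single i (x i)).
Proof.
move=> uF supp x; rewrite -prod_map_sum.
set y := fun i => _; apply/eqP; rewrite -subr_eq0 -scaleN1r -fZ -fD; apply/eqP.
apply: supp => k kF; rewrite scaleN1r /y (bigD1_seq k) //= single_eq.
by rewrite big1 ?addr0 ?subrr // => i; apply: single_neq.
Qed.

End ProductMap.
Arguments single {R I A}.

(** * Counting members of one class *)

Section ClassCount.
Context {R : pzRingType} {Ob : lmodType R^c -> Prop}.
Context {P Q : forall A B : lmodType R^c, (A -> B) -> Prop}.
Arguments P : clear implicits.
Arguments Q : clear implicits.
Hypotheses (HP : completely_prime Ob P) (HQ : completely_prime Ob Q).
Hypothesis Haut : forall A, Ob A -> forall f : A -> A, rhom f ->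
  (module_automorphism f <-> ~ (P A A f \/ Q A A f)).
Hypothesis Hsl : forall A, Ob A -> slender A.

Lemma class_size_le (I J : choiceType) (A : I -> lmodType R^c)
    (B : J -> lmodType R^c) (C : lmodType R^c)
    (Phi : (forall i, A i) -> (forall j, B j))
    (Psi : (forall j, B j) -> (forall i, A i)) (js : seq J) :
  (forall i, Ob (A i)) -> (forall j, Ob (B j)) -> Ob C -> nonmeasurable I ->
  (forall x y, Phi (fun i => x i + y i) = (fun j => Phi x j + Phi y j)) ->
  (forall (r : R^c) x, Phi (fun i => r *: x i) = (fun j => r *: Phi x j)) ->
  (forall x y, Psi (fun i => x i + y i) = (fun j => Psi x j + Psi y j)) ->
  (forall (r : R^c) x, Psi (fun i => r *: x i) = (fun j => r *: Psi x j)) ->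
  cancel Psi Phi -> uniq js -> {in js, forall j, same_class P (B j) C} ->
  exists s : seq I,
    [/\ uniq s, {in s, forall i, same_class P (A i) C} & (size js <= size s)%N].
Proof.
move=> oA oB oC nmI PhiD PhiZ PsiD PsiZ PsiK ujs jsC.
have phiD j x y : Phi (fun i => x i + y i) j = Phi x j + Phi y j by rewrite PhiD.
have phiZ j r x : Phi (fun i => r *: x i) j = r *: Phi x j by rewrite PhiZ.
have psiD i x y : Psi (fun i => x i + y i) i = Psi x i + Psi y i by rewrite PsiD.
have psiZ i r x : Psi (fun i => r *: x i) i = r *: Psi x i by rewrite PsiZ.
have /choice[F HF] j := hom_prod_slender_finite_support (phiD j) (phiZ j) (Hsl (oB j)) nmI.
(* [G] covers the supports of all rows in [js], so sums over [G] compute these rows of [Phi] after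
   [Psi] exactly. *)
pose G := undup (flatten [seq F j | j <- js]).
pose phi j i a := Phi (single i a) j.
pose psi i j b := Psi (single j b) i.
have hphi j i : rhom (phi j i) := comp_single_rhom (phiD j) (phiZ j) i.
have hpsi i j : rhom (psi i j) := comp_single_rhom (psiD i) (psiZ i) j.
have sumE j k b : j \in js -> \sum_(i <- G) phi j i (psi i k b) = single k b j.
  move=> jjs; rewrite -[in RHS](PsiK (single k b)).
  rewrite (finite_support_sum (phiD j) (phiZ j) (F := G)) ?undup_uniq // => x xG.
  apply: (HF j).2 => i iF; apply: xG; rewrite mem_undup.
  by apply/flattenP; exists (F j) => //; apply: map_f.
pose p i := `[< same_class P (A i) C >].
(* If the route from [B k] through [A i] to [B j] is outside [P], so are both halves. Returning from
   [B j] to [B k] by some [g] outside [P] then puts [A i] in the class of [B k]. *)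
have off j k i : j \in js -> k \in js -> ~~ p i ->
    P (B k) (B j) (fun b => phi j i (psi i k b)).
  move=> jjs kjs /asboolPn nAC; apply: contrapT => nP; apply: nAC.
  have [g [hg ng]] : exists g : B j -> B k, rhom g /\ ~ P (B j) (B k) g.
    have := same_class_trans HP (oB j) oC (oB k) (jsC j jjs) (same_class_sym (jsC k kjs)).
    by case.
  apply: same_class_trans (oA i) (oB k) oC _ (jsC k kjs) => //.
  split; [exists (fun a => g (phi j i a))|exists (psi i k)]; split=> //.
  - exact: rhom_comp.
  - move=> /(ideal_prime HP)[] // Pphi; apply: nP.
    exact: (ideal_compr HP (oB k) (oA i) (oB j)).
  - by move=> Ppsi; apply: nP; apply: (ideal_compl HP (oB k) (oA i) (oB j)).
(* [single k b j] acts as a Kronecker delta, covering diagonal and off-diagonal entries together. *)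
have sumP j k : j \in js -> k \in js -> P (B k) (B j)
    (fun b => \sum_(i <- [seq i <- G | p i]) phi j i (psi i k b) - single k b j).
  move=> jjs kjs.
  have Poff : P (B k) (B j) (fun b => \sum_(i <- G | ~~ p i) phi j i (psi i k b)).
    by apply: (ideal_sum HP) => // i; apply: off.
  have := ideal_sub HP (oB k) (oB j) (ideal0 HP (oB k) (oB j)) Poff.
  congr P; apply/funext => b; rewrite big_filter -(sumE j k b jjs) [\sum_(i <- G) _](bigID p) /=.
  by rewrite opprD addrA subrr.
exists [seq i <- G | p i]; split; first exact/filter_uniq/undup_uniq.
  by move=> i; rewrite mem_filter => /andP[/asboolP].
apply: (size_le_of_identity_mod HP HQ Haut oA oB hphi hpsi ujs).
  move=> j jjs; have := sumP j j jjs jjs.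
  by congr P; apply/funext => b; rewrite single_eq.
move=> j k jjs kjs jk; have := sumP j k jjs kjs.
by congr P; apply/funext => b; rewrite single_neq ?subr0 // eq_sym.
Qed.

End ClassCount.

(** * Cardinalities and gluing of bijections *)

(** A finite [T] is itself enumerated by some [js]. If [T] is infinite, [S] has arbitrarily large
    finite subsets, hence is infinite, and the countable [T] embeds in it. *)
Lemma card_le_of_uniq_seqs (I J : choiceType) (S : set I) (T : set J) :
  countable T ->
  (forall js : seq J, uniq js -> {in js, forall j, T j} ->
     exists s : seq I, [/\ uniq s, {in s, forall i, S i} & (size js <= size s)%N]) ->
  (T #<= S)%card.
Proof.
move=> cT TS.
have seq_card (s : seq I) : uniq s -> {in s, forall i, S i} ->
    exists2 X : {fset I}, ([set` X] `<=` S)%classic & #|` X|%fset = size s.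
  move=> us sS; exists [fset i in s]%fset.
    by move=> i /=; rewrite inE => /sS.
  by rewrite card_fseq undup_id.
have [finT|infT] := pselect (finite_set T).
  have [||s [us sS les]] := TS (fset_set T); first exact: fset_uniq.
    by move=> j; rewrite in_fset_set // inE.
  have [X XS cX] := seq_card s us sS.
  have [n Tn] := finT; rewrite (card_le_eql Tn).
  apply: card_le_trans (subset_card_le XS).
  have Xs : ([set` X]%classic #= `I_(size s))%card by apply/card_eq_fsetP.
  by rewrite (card_le_eqr Xs) card_le_II -(card_fset_set Tn).
apply: card_le_trans cT _; apply/infiniteP/infinite_set_fsetP => n.
have [X XT nX] := infinite_set_fset n infT.
have [||s [us sS les]] := TS X; first exact: fset_uniq.
  by move=> j; apply: XT.
by have [Y YS cY] := seq_card s us sS; exists Y; rewrite // cY (leq_trans nX).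
Qed.

Lemma countable_setE (T : Type) (S : set T) : countable_set S -> countable S.
Proof.
move=> [h hinj]; apply/countable_injP.
exists (fun x => if pselect (S x) is left Sx then h (exist _ x Sx) else 0%N).
move=> x y /set_mem Sx /set_mem Sy.
by case: pselect => // Sx'; case: pselect => // Sy' /hinj [].
Qed.

(** Bijections chosen fibre by fibre are glued, together with their inverses. *)
Lemma bijection_of_fibers (I J K : Type) (a : I -> K) (b : J -> K) :
  (forall k, [set i | a i = k]%classic #= [set j | b j = k]%classic)%card ->
  exists2 s : I -> J, bijective s & forall i, b (s i) = a i.
Proof.
move=> ab.
pose S k : set I := [set i | a i = k]%classic; pose T k : set J := [set j | b j = k]%classic.
have h k : {fg : (S k -> T k) * (T k -> S k) | cancel fg.1 fg.2 /\ cancel fg.2 fg.1}.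
  by apply: cid; have /card_bijP[f [g fK gK]] := ab k; exists (f, g).
pose elS k i (e : a i = k) : S k := SigSub (mem_set (e : S k i)).
pose elT k j (e : b j = k) : T k := SigSub (mem_set (e : T k j)).
pose s i := val ((sval (h (a i))).1 (elS _ i erefl)).
pose t j := val ((sval (h (b j))).2 (elT _ j erefl)).
(* Allowing any [k] equal to [a i] lets [s] be evaluated at [t j] in the fibre over [b j]. *)
have sE k i (e : a i = k) : s i = val ((sval (h k)).1 (elS _ i e)) by case: k / e.
have tE k j (e : b j = k) : t j = val ((sval (h k)).2 (elT _ j e)) by case: k / e.
have bs i : b (s i) = a i := set_mem (valP ((sval (h (a i))).1 (elS _ i erefl))).
have atj j : a (t j) = b j := set_mem (valP ((sval (h (b j))).2 (elT _ j erefl))).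
exists s => //; exists t => [i|j].
  rewrite (tE _ _ (bs i)) (_ : elT _ _ _ = (sval (h (a i))).1 (elS _ i erefl)).
    by rewrite (svalP (h (a i))).1.
  exact: val_inj.
rewrite (sE _ _ (atj j)) (_ : elS _ _ _ = (sval (h (b j))).2 (elT _ j erefl)).
  by rewrite (svalP (h (b j))).2.
exact: val_inj.
Qed.
Lemma prod_iso_inverse (R : pzRingType) (I J : Type) (A : I -> lmodType R^c)
    (B : J -> lmodType R^c) (Phi : (forall i, A i) -> (forall j, B j)) :
  prod_iso Phi -> exists Psi, [/\ prod_iso Psi, cancel Phi Psi & cancel Psi Phi].
Proof.
move=> [[Psi PhiK PsiK] [PhiD PhiZ]]; exists Psi; split=> //.
split; first by exists Phi.
split=> [x y|r x]; apply: (can_inj PhiK); rewrite PsiK ?PhiD ?PhiZ;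
  by apply: functional_extensionality_dep => j; rewrite !PsiK.
Qed.

(** * From class sizes to bijections *)

Section ClassBijection.
Context {R : pzRingType} {Ob : lmodType R^c -> Prop}.
Context {P Q : forall A B : lmodType R^c, (A -> B) -> Prop}.
Arguments P : clear implicits.
Arguments Q : clear implicits.
Hypotheses (HP : completely_prime Ob P) (HQ : completely_prime Ob Q).
Hypothesis Haut : forall A, Ob A -> forall f : A -> A, rhom f ->
  (module_automorphism f <-> ~ (P A A f \/ Q A A f)).
Hypothesis Hsl : forall A, Ob A -> slender A.

(** A class is encoded as the set of its members, so that being in the same class becomes equality
    and the classes of a family become fibres of a map. *)
Definition class_of (A : lmodType R^c) : lmodType R^c -> Prop :=
  fun X => Ob X /\ same_class P X A.

Lemma class_of_eq A B : Ob A -> Ob B ->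
  class_of A = class_of B <-> same_class P A B.
Proof.
move=> oA oB; split=> [AB|AB].
  have : class_of A A by split=> //; apply: (same_class_refl HP).
  by rewrite AB => -[].
apply/funext => X; apply/propext; split=> -[oX XA]; split=> //.
  exact: (same_class_trans HP oX oA oB XA AB).
exact: (same_class_trans HP oX oB oA XA (same_class_sym AB)).
Qed.

Lemma class_fiber_card_le (I J : choiceType) (A : I -> lmodType R^c)
    (B : J -> lmodType R^c) (Phi : (forall i, A i) -> (forall j, B j)) k :
  (forall i, Ob (A i)) -> (forall j, Ob (B j)) -> nonmeasurable I ->
  (forall j, countable_set (fun j' => same_class P (B j') (B j))) ->
  prod_iso Phi ->
  ([set j | class_of (B j) = k] #<= [set i | class_of (A i) = k])%classic%card.
Proof.
move=> oA oB nmI cB Phi_iso; have [Psi [Psi_iso PhiK PsiK]] := prod_iso_inverse Phi_iso.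
apply: card_le_of_uniq_seqs => [|js ujs jsk].
  (* [k] is arbitrary, so its fibre may be empty. *)
  have [[j0 j0k]|Bk] := pselect (exists j, class_of (B j) = k); last first.
    rewrite (_ : mkset _ = set0) //; apply/seteqP; split=> // j jk.
    by apply: Bk; exists j.
  apply: sub_countable (countable_setE (cB j0)); apply: subset_card_le => j /= jk.
  by apply/class_of_eq => //; rewrite jk.
case: js => [|j0 js] in ujs jsk *; first by exists [::].
have j0k := jsk j0 (mem_head _ _).
have jsC : {in j0 :: js, forall j, same_class P (B j) (B j0)}.
  by move=> j /jsk jk; apply/class_of_eq => //; rewrite jk j0k.
have [_ [PhiD PhiZ]] := Phi_iso; have [_ [PsiD PsiZ]] := Psi_iso.
have [s [us sC les]] :=
  class_size_le HP HQ Haut Hsl oA oB (oB j0) nmI PhiD PhiZ PsiD PsiZ PsiK ujs jsC.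
by exists s; split=> // i /sC iC; rewrite /= -j0k; apply/class_of_eq.
Qed.

Lemma exists_class_bijection (I J : choiceType) (A : I -> lmodType R^c)
    (B : J -> lmodType R^c) (Phi : (forall i, A i) -> (forall j, B j)) :
  (forall i, Ob (A i)) -> (forall j, Ob (B j)) ->
  nonmeasurable I -> nonmeasurable J ->
  (forall i, countable_set (fun i' => same_class P (A i') (A i))) ->
  (forall j, countable_set (fun j' => same_class P (B j') (B j))) ->
  prod_iso Phi ->
  exists2 s : I -> J, bijective s & forall i, same_class P (A i) (B (s i)).
Proof.
move=> oA oB nmI nmJ cA cB Phi_iso; have [Psi [Psi_iso _ _]] := prod_iso_inverse Phi_iso.
have [k|s bij_s sAB] := @bijection_of_fibers I J _ (class_of \o A) (class_of \o B).
  rewrite card_eq_le; apply/andP; split.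
    exact: class_fiber_card_le cA Psi_iso.
  exact: class_fiber_card_le cB Phi_iso.
by exists s => // i; apply/class_of_eq => //; rewrite [RHS]sAB.
Qed.

End ClassBijection.

Theorem theorem5p3 (R : pzRingType) (Ob : lmodType R^c -> Prop)
  (P Q : forall A B : lmodType R^c, (A -> B) -> Prop)
  (HobC : forall A, Ob A -> indecomposable A /\ slender A)
  (HP : completely_prime Ob P) (HQ : completely_prime Ob Q)
  (Haut : forall A, Ob A -> forall f : A -> A, rhom f ->
            (module_automorphism f <-> ~ (P A A f \/ Q A A f)))
  (Hdsp : DSP Ob)
  (I J : Type) (A : I -> lmodType R^c) (B : J -> lmodType R^c)
  (HA : forall i, Ob (A i)) (HB : forall j, Ob (B j))
  (HI : nonmeasurable I) (HJ : nonmeasurable J)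
  (HaA : forall i, countable_set (fun i' => same_class P (A i') (A i)))
  (HaB : forall j, countable_set (fun j' => same_class P (B j') (B j)))
  (HbA : forall i, countable_set (fun i' => same_class Q (A i') (A i)))
  (HbB : forall j, countable_set (fun j' => same_class Q (B j') (B j)))
  (Hc : exists Phi : (forall i, A i) -> (forall j, B j), prod_iso Phi) :
  exists sigma tau : I -> J, bijective sigma /\ bijective tau /\
    forall i, same_class P (A i) (B (sigma i)) /\ same_class Q (A i) (B (tau i)).
Proof.
have [Phi Phi_iso] := Hc.
have slOb C : Ob C -> slender C by case/HobC.
(* [{classic I}] equips the bare type [I] with a choice structure. *)
have [s bij_s sP] := @exists_class_bijection _ _ _ _ HP HQ Haut slOb
  {classic I} {classic J} A B Phi HA HB HI HJ HaA HaB Phi_iso.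
(* The automorphism criterion is symmetric in [P] and [Q], so [tau] is obtained by exchanging their
   roles. *)
have HautQ C (oC : Ob C) (f : C -> C) (hf : rhom f) :
    module_automorphism f <-> ~ (Q C C f \/ P C C f).
  by rewrite or_comm; apply: Haut.
have [t bij_t tQ] := @exists_class_bijection _ _ _ _ HQ HP HautQ slOb
  {classic I} {classic J} A B Phi HA HB HI HJ HbA HbB Phi_iso.
by exists s, t; do 2?split=> //; split.
Qed.
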